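(* For $T>2\pi$ let $P=\sqrt{T/(2\pi)}$, let $w_\infty(x)=\frac{1}{2}\sqrt{\frac{3}{\pi}}\,\frac{1}{\ln^{3/2}P}\,e^{-\beta x^2}$ for $x\in\mathbb{R}$, where $\beta=\frac{3}{4\ln^3 P}$, and let $$E_\infty\left(\sqrt{1+(\Phi_1)^2}\right)=\int_{-\infty}^{\infty}\sqrt{1+x^2}\,w_\infty(x)\,dx .$$ Then $$E_\infty\left(\sqrt{1+(\Phi_1)^2}\right)\sim \frac{1}{\sqrt{6\pi}}\ln^{3/2}T,\qquad T\to\infty .$$
   Context: Here $\ln^{a}x=(\ln x)^{a}$. The symbol $E_\infty(\sqrt{1+(\Phi_1)^2})$ is defined by the displayed integral (called the asymptotic expectation); it depends only on $T$. The density $w_\infty$ is the centered Gaussian density with variance $\frac23\ln^3P$. The notation $f\sim g$ as $T\to\infty$ means $f/g\to1$. *)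

(* Defs.v *)
From HB Require Import structures.
From mathcomp Require Import all_boot all_order all_algebra.
From mathcomp Require Import all_classical all_reals all_analysis.
Import Order.TTheory GRing.Theory Num.Theory.
Import numFieldNormedType.Exports.

Set Implicit Arguments.
Unset Strict Implicit.
Unset Printing Implicit Defensive.

Local Open Scope classical_set_scope.
Local Open Scope ring_scope.

(* The functions of T below are total; they are meaningful for T > 2 * pi,
   where P > 1 and hence ln P > 0. *)

Definition PT (R : realType) (T : R) : R := Num.sqrt (T / (2 * pi)).

Definition beta (R : realType) (T : R) : R := 3 / (4 * ln (PT T) ^+ 3).

Definition w_infty (R : realType) (T x : R) : R :=
  2^-1 * Num.sqrt (3 / pi) * (ln (PT T) `^ (3 / 2))^-1
  * expR (- beta T * x ^+ 2).

Definition E_infty (R : realType) (T : R) : R :=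
  \int[@lebesgue_measure R]_x (Num.sqrt (1 + x ^+ 2) * w_infty T x).

(* f ~ g at infinity, in the sense f / g --> 1. *)
Definition asymp_equiv (R : realType) (f g : R -> R) : Prop :=
  f T / g T @[T --> +oo] --> (1 : R).

(* Main.v *)
Require Import Defs.
From mathcomp Require Import all_boot all_order all_algebra.
From mathcomp Require Import all_classical all_reals all_analysis.
From mathcomp Require Import measurable_realfun ring lra.
Import Order.TTheory GRing.Theory Num.Theory.
Import numFieldNormedType.Exports.
Local Open Scope classical_set_scope.
Local Open Scope ring_scope.

(** Since |x| <= sqrt (1 + x^2) <= |x| + 1, the expectation of sqrt (1 + X^2)
    under a centered Gaussian of standard deviation s differs from the one of
    |X|, which is sqrt (2 / pi) * s, by at most 1.  Here s^2 = 2/3 * ln^3 P and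
    2 * ln P = ln T - ln (2 * pi), so sqrt (2 / pi) * s is
    (6 * pi)^(-1/2) * ln^(3/2) T times (1 - ln (2 * pi) / ln T)^(3/2), and the
    bounded error is negligible. *)

(** The integrand has the antiderivative [F] below, which tends to 0 at [+oo], so only [- F 0]
    survives. *)
Lemma integral0y_idM_gauss (R : realType) (b : R) : 0 < b ->
  (\int[@lebesgue_measure R]_(x in `[0%R, +oo[)
     (x * expR (- b * x ^+ 2))%:E = (2 * b)^-1%:E)%E.
Proof.
move=> b0.
pose F (x : R) := - (2 * b)^-1 * expR (- b * x ^+ 2).
have dF (x : R) : is_derive x 1 F (x * expR (- b * x ^+ 2)).
  (* The derivative is laid out in the nested form that the scaling, chain and power rules
     produce. *)
  have -> : x * expR (- b * x ^+ 2) =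
      - (2 * b)^-1 *: (expR (- b * x ^+ 2) *: (- b *: (2%:R * x ^+ 1 *: 1))).
    rewrite /GRing.scale/=; field; lra.
  apply: is_deriveZ.
  apply: (is_derive1_comp (f := expR) (g := fun y => - b * y ^+ 2)).
  by apply: is_deriveZ; apply: (@is_deriveX _ _ id 2).
have cF : continuous F.
  by move=> x; apply/differentiable_continuous/derivable1_diffP; have [] := dF x.
rewrite (@ge0_continuous_FTC2y R _ F 0 0).
- by rewrite /F expr0n/= mulr0 expR0 mulr1 -EFinB sub0r opprK.
- by move=> x x0; rewrite mulr_ge0// expR_ge0.
- apply: continuous_subspaceT => x; apply: cvgM; first exact: cvg_id.
  apply: continuous_comp; last exact: continuous_expR.
  by apply: cvgM; [exact: cvg_cst|exact: exprn_continuous].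
- rewrite -(mulr0 (- (2 * b)^-1)); apply: cvgMr.
  under eq_fun do rewrite mulNr.
  apply: (cvg_comp (fun x : R => b * x ^+ 2) (fun x => expR (- x))).
    by apply: gt0_cvgMry => //; exact: cvgr_expr2.
  exact: cvgr_expR.
- by move=> x _; have [] := dF x.
- exact/cvg_at_right_filter/cF.
- by move=> x _; rewrite derive1E; apply: derive_val.
Qed.

(** By evenness this is twice the integral over the half-line, where the previous lemma with
    [b = (2 * s ^+ 2)^-1] contributes [s ^+ 2]; it remains to simplify
    [2 * normal_peak s * s ^+ 2]. *)
Lemma integral_abs_normal_pdf (R : realType) (s : R) : 0 < s ->
  (\int[@lebesgue_measure R]_x (`|x| * normal_pdf 0 s x)%:E =
   (Num.sqrt (2 / pi) * s)%:E)%E.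
Proof.
move=> s0; have sn0 : s != 0 by rewrite gt_eqF.
rewrite ge0_symfun_integralT; last 3 first.
- by move=> x; rewrite mulr_ge0// normal_pdf_ge0.
- move=> x; apply: cvgM; first exact: norm_continuous.
  exact: continuous_normal_pdf.
- by move=> x /=; rewrite normrN !normal_pdfE// /normal_fun !subr0 sqrrN.
rewrite -set_itvcy.
transitivity (2%:E * \int[@lebesgue_measure R]_(x in `[0%R, +oo[)
    ((normal_peak s)%:E * (x * expR (- (2 * s ^+ 2)^-1 * x ^+ 2))%:E))%E.
  congr (_ * _)%E; apply: eq_integral => x; rewrite inE/= in_itv/= andbT => x0.
  rewrite -EFinM ger0_norm// normal_pdfE// /normal_fun subr0.
  by rewrite mulrCA !mulNr [_ / _]mulrC -mulr_natl.
rewrite ge0_integralZl_EFin//=; last 3 first.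
- by move=> x; rewrite in_itv/= andbT => x0; rewrite lee_fin mulr_ge0// expR_ge0.
- apply/measurable_EFinP/measurable_funTS/measurable_funM => //.
  apply: measurableT_comp => //; apply: measurable_funM => //.
- exact: normal_peak_ge0.
rewrite integral0y_idM_gauss; last by rewrite invr_gt0 mulr_gt0// exprn_gt0.
rewrite -!EFinM; congr EFin; rewrite /normal_peak.
move: (pi : R) (pi_gt0 R) => p p0.
(* Both radicals are expressed through the single root [Num.sqrt (2 * p)], which leaves a rational
   identity. *)
have -> : s ^+ 2 * p *+ 2 = (s * Num.sqrt (2 * p)) ^+ 2.
  by rewrite exprMn sqr_sqrtr ?mulr_ge0 ?ltW// -mulr_natr; ring.
rewrite sqrtr_sqr ger0_norm ?mulr_ge0 ?sqrtr_ge0 ?ltW//.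
have -> : Num.sqrt (2 / p) = 2 / Num.sqrt (2 * p) :> R.
  have -> : 2 / p = 2 ^+ 2 / (2 * p) :> R by field; rewrite gt_eqF.
  by rewrite sqrtrM ?exprn_ge0// sqrtr_sqr ger0_norm// sqrtrV// mulr_ge0// ltW.
have : Num.sqrt (2 * p) != 0 :> R by rewrite gt_eqF// sqrtr_gt0 mulr_gt0.
move: (Num.sqrt _) => r r0; by field; rewrite r0 sn0.
Qed.

Lemma integrable_abs_normal_pdf (R : realType) (s : R) : 0 < s ->
  (@lebesgue_measure R).-integrable setT
    (EFin \o (fun x => `|x| * normal_pdf 0 s x)).
Proof.
move=> s0; have mf : measurable_fun [set: R] (fun x : R => `|x| * normal_pdf 0 s x).
  by apply: measurable_funM => //; exact: measurable_normal_pdf.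
apply/integrableP; split; first exact/measurable_EFinP.
under eq_integral do
  rewrite /= ger0_norm ?mulr_ge0 ?normal_pdf_ge0//.
by rewrite integral_abs_normal_pdf// ltry.
Qed.

Lemma integral_sqrt1D_normal_pdf_bounds (R : realType) (s : R) : 0 < s ->
  Num.sqrt (2 / pi) * s
    <= \int[@lebesgue_measure R]_x (Num.sqrt (1 + x ^+ 2) * normal_pdf 0 s x)
    <= Num.sqrt (2 / pi) * s + 1.
Proof.
move=> s0.
have ia := integrable_abs_normal_pdf _ _ s0.
have ip : (@lebesgue_measure R).-integrable setT (EFin \o normal_pdf 0 s).
  exact: integrable_normal_pdf.
have lo (x : R) : `|x| <= Num.sqrt (1 + x ^+ 2).
  by rewrite -sqrtr_sqr ler_wsqrtr// lerDr.
(* This bound serves twice: it dominates the integrand, giving integrability, and then yields the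
   upper estimate. *)
have hi (x : R) : Num.sqrt (1 + x ^+ 2) * normal_pdf 0 s x
    <= `|x| * normal_pdf 0 s x + normal_pdf 0 s x.
  rewrite -[X in _ <= _ + X]mul1r -mulrDl ler_wpM2r ?normal_pdf_ge0//.
  rewrite -[leRHS]ger0_norm ?addr_ge0// -sqrtr_sqr ler_wsqrtr//.
  by rewrite sqrrD real_normK ?num_real// expr1n; have := normr_ge0 x; lra.
have ih : (@lebesgue_measure R).-integrable setT
    (EFin \o (fun x => `|x| * normal_pdf 0 s x + normal_pdf 0 s x)).
  exact: (integrableD _ ia ip).
have is1 : (@lebesgue_measure R).-integrable setT
    (EFin \o (fun x => Num.sqrt (1 + x ^+ 2) * normal_pdf 0 s x)).
  apply: le_integrable ih => //.
    apply/measurable_EFinP/measurable_funM; last exact: measurable_normal_pdf.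
    apply: continuous_measurable_fun => x.
    apply: continuous_comp; last exact: sqrt_continuous.
    by apply: cvgD; [exact: cvg_cst|exact: exprn_continuous].
  move=> x _ /=; rewrite lee_fin ger0_norm ?mulr_ge0 ?normal_pdf_ge0//.
  exact: le_trans (hi x) (ler_norm _).
have <- : \int[@lebesgue_measure R]_x (`|x| * normal_pdf 0 s x)
    = Num.sqrt (2 / pi) * s.
  by rewrite /Rintegral integral_abs_normal_pdf.
apply/andP; split.
  by apply: le_Rintegral => // x _; rewrite ler_wpM2r ?normal_pdf_ge0.
(* The additive constant 1 of the upper bound is the total mass of the density. *)
have ip1 : \int[@lebesgue_measure R]_x (normal_pdf 0 s x) = 1.
  by rewrite /Rintegral integral_normal_pdf.
by rewrite -[X in _ <= _ + X]ip1 -RintegralD//; apply: le_Rintegral.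
Qed.

(** Trades real powers for square roots, so that all radicals can be merged or split by [sqrtrM]. *)
Lemma powR3half (R : realType) (a : R) : 0 <= a ->
  a `^ (3 / 2) = Num.sqrt (a ^+ 3).
Proof. by move=> a0; rewrite powRrM powR12_sqrt ?powR_ge0// powR_mulrn. Qed.

(** With [V] the cube of [ln (PT T)] and variance [s ^+ 2 = 2 / 3 * V], one has
    [(2 * s ^+ 2)^-1 = 3 / (4 * V)], which is [beta T]. Positivity of the logarithm keeps [s] away
    from the degenerate case 0. *)
Lemma w_infty_normal_pdf (R : realType) (T : R) : 0 < ln (PT T) ->
  w_infty T = normal_pdf 0 (Num.sqrt (2 / 3 * ln (PT T) ^+ 3)).
Proof.
move=> L0; apply/funext => x; rewrite /w_infty /beta powR3half ?ltW//.
have : 0 < ln (PT T) ^+ 3 by rewrite exprn_gt0.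
move: (ln (PT T) ^+ 3) => V V0.
rewrite normal_pdfE ?gt_eqF ?sqrtr_gt0 ?mulr_gt0//.
rewrite /normal_fun /normal_peak; move: (pi : R) (pi_gt0 R) => p p0; rewrite subr0 sqr_sqrtr ?mulr_ge0 ?ltW//.
congr (_ * expR _); last by field; rewrite gt_eqF.
(* The factors are grouped so that the inverse root splits into [2^-1], [Num.sqrt (3 / p)] and
   [(Num.sqrt V)^-1]. *)
have -> : 2 / 3 * V * p *+ 2 = 2 ^+ 2 * ((3 / p)^-1 * V).
  by rewrite -mulr_natr; field; rewrite gt_eqF.
have q0 : 0 <= 3 / p by rewrite divr_ge0 ?ltW.
rewrite [in RHS]sqrtrM ?exprn_ge0// sqrtr_sqr ger0_norm//.
by rewrite [Num.sqrt (_ * V)]sqrtrM ?invr_ge0// sqrtrV// !invfM invrK mulrA.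
Qed.

Lemma ln_PT (R : realType) (T : R) : 0 < T -> 2 * ln (PT T) = ln T - ln (2 * pi).
Proof.
move=> T0; have p0 := pi_gt0 R.
have q0 : 0 < T / (2 * pi) by rewrite divr_gt0// mulr_gt0.
rewrite /PT -powR12_sqrt ?ltW// ln_powR mulrA divff// mul1r.
by rewrite ln_div// posrE ?mulr_gt0.
Qed.

Lemma cvg_lny (R : realType) : ln T @[T --> (+oo : set_system R)] --> +oo.
Proof.
apply/cvgryPge => A; near=> T.
have AT : expR A <= T by near: T; exact: nbhs_pinfty_ge.
by rewrite -(expRK A) ler_ln ?posrE ?(lt_le_trans _ AT) ?expR_gt0.
Unshelve. all: by end_near. Qed.

Theorem mainTheorem1 (R : realType) :
  asymp_equiv (@E_infty R)
    (fun T : R => (Num.sqrt (6 * pi))^-1 * ln T `^ (3 / 2)).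
Proof.
have p0 := pi_gt0 R.
pose g (T : R) := (Num.sqrt (6 * pi))^-1 * ln T `^ (3 / 2).
(* For large [T] this is exactly the mean of the absolute value divided by [g T]. *)
pose r (T : R) := Num.sqrt ((1 - ln (2 * pi) / ln T) ^+ 3).
have lnV0 : (ln T)^-1 @[T --> (+oo : set_system R)] --> (0 : R).
  apply/gtr0_cvgV0; last exact: cvg_lny.
  exact: cvgry_gt (cvg_lny _) 0.
have cr : r T @[T --> +oo] --> (1 : R).
  have c1 : 1 - ln (2 * pi) / ln T @[T --> +oo] --> (1 : R).
    rewrite -[X in _ --> X](subr0 1) -(mulr0 (ln (2 * pi))).
    by apply: cvgB; [exact: cvg_cst|exact: cvgMl_tmp].
  rewrite -[X in _ --> X]sqrtr1 -[X in Num.sqrt X](expr1n _ 3).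
  apply: (@cvg_comp _ _ _ (fun T : R => (1 - ln (2 * pi) / ln T) ^+ 3) Num.sqrt);
    last exact: sqrt_continuous.
  apply: (@cvg_comp _ _ _ (fun T : R => 1 - ln (2 * pi) / ln T) (fun x => x ^+ 3));
    [exact: c1|exact: exprn_continuous].
have cg : (g T)^-1 @[T --> +oo] --> (0 : R).
  rewrite /g; under eq_fun do rewrite invfM invrK.
  rewrite -(mulr0 (Num.sqrt (6 * pi))); apply: cvgMl_tmp.
  (* Once [ln T >= 1], raising it to the power 3/2 can only increase it, so the inverse power is at
     most [(ln T)^-1]. *)
  apply: (@squeeze_cvgr _ _ _ _ (cst 0) (fun T => (ln T)^-1)) => //; last exact: cvg_cst.
  near=> T; have l1 : 1 <= ln T by near: T; exact: cvgry_ge (cvg_lny _) 1.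
  rewrite invr_ge0 powR_ge0/= lef_pV2 ?posrE ?powR_gt0 ?(lt_le_trans ltr01)//.
  by rewrite le1r_powR//; lra.
rewrite /asymp_equiv -/(g _).
(* Dividing the two bounds on the expectation by [g T] traps the ratio between [r T] and
   [r T + (g T)^-1]. *)
apply: (@squeeze_cvgr _ _ _ _ r (fun T => r T + (g T)^-1)); last 2 first.
- exact: cr.
- by rewrite -[X in _ --> X]addr0; exact: cvgD.
near=> T.
have T0 : 0 < T by near: T; exact: nbhs_pinfty_gt.
have l0 : 0 < ln T by near: T; exact: cvgry_gt (cvg_lny _) 0.
(* Equivalent to [ln (2 * pi) < ln T], which holds eventually. *)
have L0 : 0 < ln (PT T).
  rewrite -(pmulr_rgt0 _ (ltr0Sn _ 1)) ln_PT// subr_gt0.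
  by near: T; exact: cvgry_gt (cvg_lny _) _.
have g0 : 0 < g T by rewrite mulr_gt0 ?invr_gt0 ?sqrtr_gt0 ?mulr_gt0 ?powR_gt0.
have -> : r T = Num.sqrt (2 / pi) * Num.sqrt (2 / 3 * ln (PT T) ^+ 3) / g T.
  apply: esym; apply: (canLR (mulfK (lt0r_neq0 g0))).
  (* After this rewriting both sides become single square roots, and the radicands agree because
     [2 ^+ 3 / (6 * pi) = 2 / pi * (2 / 3)]. *)
  have -> : r T = Num.sqrt ((2 * ln (PT T) / ln T) ^+ 3).
    by rewrite ln_PT// mulrBl divff// gt_eqF.
  rewrite /g powR3half ?ltW// -sqrtrV ?mulr_ge0 ?ltW//.
  rewrite -!sqrtrM ?invr_ge0 ?divr_ge0 ?mulr_ge0 ?exprn_ge0 ?divr_ge0 ?mulr_ge0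
    ?ltW ?invr_gt0//.
  congr Num.sqrt.
  by move: (pi : R) p0 => p p0; field; rewrite !gt_eqF.
have := @integral_sqrt1D_normal_pdf_bounds R (Num.sqrt (2 / 3 * ln (PT T) ^+ 3)).
rewrite sqrtr_gt0 !mulr_gt0 ?exprn_gt0// => /(_ isT).
rewrite /E_infty w_infty_normal_pdf// => /andP[lb ub].
by rewrite -[X in _ <= _ + X]mul1r -mulrDl !ler_pM2r ?invr_gt0// lb ub.
Unshelve. all: by end_near. Qed.
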